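(* Let $n\ge3$, let $H\subseteq\mathbb{C}^n$ be an additive subgroup with $\operatorname{span}_{\mathbb{C}}H=\mathbb{C}^n$, and let $0\ne t\in H$. Then $\mathcal Q(P(H,t))=\mathbb{C}\,\mathrm{id}_{P(H,t)}$; that is, every $\frac1n$-derivation of $P(H,t)$ is a scalar multiple of the identity (and conversely).
   Context: All vector spaces are over $\mathbb{C}$. An $n$-Lie algebra is a vector space $L$ with an alternating $n$-linear bracket satisfying $[x_1,\ldots,x_{n-1},[y_1,\ldots,y_n]]=\sum_{i=1}^n[y_1,\ldots,[x_1,\ldots,x_{n-1},y_i],\ldots,y_n]$. $\mathcal Q(L)$ denotes the space of $\frac1n$-derivations of $L$, i.e. of linear maps $T:L\to L$ with $\sum_{i=1}^n[x_1,\ldots,T(x_i),\ldots,x_n]=n\,T([x_1,\ldots,x_n])$ for all $x_1,\ldots,x_n\in L$. $P(H,t)$: put $\Lambda=H\setminus\{0,t\}$. $P(H,t)$ is the $n$-Lie algebra with basis $\{u_a:a\in\Lambda\}$ and bracket $[u_{a_1},\ldots,u_{a_n}]=\det(a_1,\ldots,a_n)\,u_{a_1+\cdots+a_n+t}$, where $u_0=u_t=0$. *)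

(* Defs.v *)
From HB Require Import structures.
From mathcomp Require Import all_boot all_order all_fingroup all_algebra finmap.
From mathcomp Require Import boolp classical_sets reals complex.
From mathcomp Require Import monalg.

Set Implicit Arguments.
Unset Strict Implicit.
Unset Printing Implicit Defensive.

Import GRing.Theory Num.Theory.

Local Open Scope ring_scope.

Section NLieAlgebras.
Variables (K : fieldType) (n : nat).

Definition subst_at (I : finType) (T : Type) (x : {ffun I -> T}) (i : I) (z : T) :
    {ffun I -> T} :=
  [ffun j => if j == i then z else x j].

(* The tuple (x_1, ..., x_{n-1}, z): the last entry of x is discarded. *)
Definition subst_last (T : Type) (x : {ffun 'I_n -> T}) (z : T) :
    {ffun 'I_n -> T} :=
  [ffun j : 'I_n => if j.+1 == n then z else x j].

Record nLieAlgebra := NLieAlgebra {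
  nlie_space :> lmodType K;
  bracket : {ffun 'I_n -> nlie_space} -> nlie_space;
  bracket_linear : forall x i, linear (fun z => bracket (subst_at x i z));
  bracket_alternating : forall (x : {ffun 'I_n -> nlie_space}) i j,
    i != j -> x i = x j -> bracket x = 0;
  bracket_jacobi : forall x y : {ffun 'I_n -> nlie_space},
    bracket (subst_last x (bracket y)) =
    \sum_(i < n) bracket (subst_at y i (bracket (subst_last x (y i))))
}.

(* The linear maps T with \sum_i [x_1, ..., T x_i, ..., x_n] = n T[x_1, ..., x_n]. *)
Definition inv_n_derivations (L : nLieAlgebra) : set (L -> L) :=
  [set T | linear T /\
    forall x : {ffun 'I_n -> L},
      \sum_(i < n) bracket (subst_at x i (T (x i))) = T (bracket x) *+ n].

End NLieAlgebras.

Arguments inv_n_derivations {K n} L _.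

Definition in_span (K : fieldType) (V : vectType K) (A : {pred V}) (v : V) : Prop :=
  exists2 s : seq V, {subset s <= A} & v \in <<s>>%VS.

Section PHt.
Variables (K : numFieldType) (n : nat).
Variables (H : zmodClosed 'rV[K]_n) (t : 'rV[K]_n).

Definition Lambda := {a : 'rV[K]_n | [&& a \in H, a != 0 & a != t]}.

(* Finitely supported functions on Lambda, with basis << a >> = u_a. *)
Local Notation Pspace := {malg K[Lambda]}.

(* u_a, extended by u_a = 0 for a outside Lambda, in particular u_0 = u_t = 0. *)
Definition Pu (a : 'rV[K]_n) : Pspace :=
  if insub a is Some k then << (k : Lambda) >> else 0.

(* The multilinear extension of
     [u_{a_1}, ..., u_{a_n}] = det(a_1, ..., a_n) u_{a_1 + ... + a_n + t},
   see Pbracket_basis. *)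
Definition Pbracket (x : {ffun 'I_n -> Pspace}) : Pspace :=
  \sum_(a : {ffun 'I_n -> (\bigcup_(i <- enum 'I_n) msupp (x i))%fset})
    ((\prod_(i < n) mcoeff (val (a i)) (x i)) *
      \det (\matrix_(i < n) val (val (a i))))
    *: Pu (\sum_(i < n) val (val (a i)) + t).

Local Notation V := 'rV[K]_n.

Lemma Pu_val (k : Lambda) : Pu (val k) = << k >>.
Proof. by rewrite /Pu valK. Qed.

Lemma Pu_out (a : V) : ~~ [&& a \in H, a != 0 & a != t] -> Pu a = 0.
Proof. by move=> h; rewrite /Pu insubN. Qed.

Definition bterm (S : {fset Lambda}) (x : {ffun 'I_n -> Pspace})
    (a : {ffun 'I_n -> S}) : Pspace :=
    ((\prod_(i < n) mcoeff (val (a i)) (x i)) *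
      \det (\matrix_(i < n) val (val (a i))))
    *: Pu (\sum_(i < n) val (val (a i)) + t).

Lemma bterm_lin (c p q r d : K) (v : Pspace) :
  p = c * q + r -> (p * d) *: v = c *: ((q * d) *: v) + (r * d) *: v.
Proof. by move=> ->; rewrite mulrDl scalerDl scalerA mulrA. Qed.

Lemma prod_lin (c : K) (i : 'I_n) (f g h : 'I_n -> K) :
  f i = c * g i + h i -> (forall j, j != i -> f j = g j) ->
  (forall j, j != i -> f j = h j) ->
  \prod_j f j = c * (\prod_j g j) + \prod_j h j.
Proof.
move=> fi fg fh; rewrite (bigD1 i) //= [\prod_j g j](bigD1 i) //= [\prod_j h j](bigD1 i) //= fi mulrDl mulrA; congr (_ * _ + _ * _).
  by apply: eq_bigr => j; apply: fg.
by apply: eq_bigr => j; apply: fh.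
Qed.

Lemma bterm_eq (p q d e : K) (a b : V) :
  p = q -> d = e -> a = b -> (p * d) *: Pu (a + t) = (q * e) *: Pu (b + t).
Proof. by move=> -> -> ->. Qed.

Lemma PbracketE (S : {fset Lambda}) (x : {ffun 'I_n -> Pspace}) :
  (forall i, msupp (x i) `<=` S)%fset ->
  Pbracket x = \sum_(a : {ffun 'I_n -> S}) bterm x a.
Proof.
move=> sS; rewrite /Pbracket.
set S0 := (\bigcup_(i <- _) _)%fset.
have sS0 i : (msupp (x i) `<=` S0)%fset.
  by apply: (bigfcup_sup (P := xpredT)); rewrite ?mem_enum.
have S0S : (S0 `<=` S)%fset by apply/bigfcupsP => i _ _; apply: sS.
pose h (a : {ffun 'I_n -> S0}) : {ffun 'I_n -> S} := [ffun i => fincl S0S (a i)].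
have hinj : injective h.
  move=> a b /ffunP e; apply/ffunP => i; have := e i; rewrite !ffunE => /(congr1 val) /= e'.
  exact: val_inj.
have hE a : bterm x (h a) = bterm x a.
  apply: bterm_eq.
  - by apply: eq_bigr => i _; rewrite ffunE.
  - by congr (\det _); apply/matrixP => i j; rewrite !mxE ffunE.
  - by apply: eq_bigr => i _; rewrite ffunE.
rewrite [RHS](bigID (fun a => a \in h @: [set: {ffun 'I_n -> S0}]%SET)) /=.
rewrite [X in _ = _ + X]big1 ?addr0; last first.
  move=> a; have [[i hi]|no] := pselect (exists i, val (a i) \notin S0).
    move=> _; rewrite /bterm (bigD1 i) //= mcoeff_outdom ?mul0r ?scale0r //.
    by apply: contra hi; apply: (fsubsetP (sS0 i)).
  have al i : val (a i) \in S0 by apply/negPn/negP => hi; apply: no; exists i.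
  move/negP; case; apply/imsetP; exists [ffun i => [` al i]%fset]; first by rewrite inE.
  by apply/ffunP => i; rewrite !ffunE; apply: val_inj.
rewrite big_imset /=; last by move=> a b _ _; apply: hinj.
apply: eq_big => [a|a _]; first by rewrite inE.
by rewrite hE.
Qed.

Lemma subst_atE (I : finType) T (x : {ffun I -> T}) i z j :
  subst_at x i z j = if j == i then z else x j.
Proof. by rewrite ffunE. Qed.

Lemma subst_at_id (I : finType) T (x : {ffun I -> T}) i : subst_at x i (x i) = x.
Proof. by apply/ffunP => j; rewrite ffunE; case: eqP => // ->. Qed.

Lemma subst_at2 (I : finType) T (x : {ffun I -> T}) i y z :
  subst_at (subst_at x i y) i z = subst_at x i z.
Proof. by apply/ffunP => j; rewrite !ffunE; case: eqP. Qed.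

Lemma subst_atC (I : finType) T (x : {ffun I -> T}) i j y z : i != j ->
  subst_at (subst_at x i y) j z = subst_at (subst_at x j z) i y.
Proof.
by move=> ij; apply/ffunP => k; rewrite !ffunE; case: eqP => // ->; rewrite eq_sym (negPf ij).
Qed.

Lemma Pbracket_linear x i : linear (fun z => Pbracket (subst_at x i z)).
Proof.
move=> c z w.
pose S := (\bigcup_(j <- enum 'I_n) msupp (x j) `|` (msupp z `|` msupp w `|` msupp (c *: z + w)))%fset.
have sS (v : Pspace) : (msupp v `<=` msupp z `|` msupp w `|` msupp (c *: z + w))%fset ->
    forall j, (msupp (subst_at x i v j) `<=` S)%fset.
  move=> hv j; rewrite subst_atE; case: eqP => _.
    exact: (fsubset_trans hv (fsubsetUr _ _)).
  apply: fsubset_trans (fsubsetUl _ _).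
  by apply: (bigfcup_sup (P := xpredT)); rewrite ?mem_enum.
have sz : (msupp z `<=` msupp z `|` msupp w `|` msupp (c *: z + w))%fset.
  by rewrite -fsetUA fsubsetUl.
have sw : (msupp w `<=` msupp z `|` msupp w `|` msupp (c *: z + w))%fset.
  by rewrite fsetUAC fsubsetUr.
have szw : (msupp (c *: z + w) `<=` msupp z `|` msupp w `|` msupp (c *: z + w))%fset.
  by rewrite fsubsetUr.
rewrite (PbracketE (sS _ szw)) (PbracketE (sS _ sz)) (PbracketE (sS _ sw)).
rewrite scaler_sumr -big_split /=; apply: eq_bigr => a _.
apply: bterm_lin.
apply: (@prod_lin _ i); last 2 first.
- by move=> j /negPf ji; rewrite !subst_atE ji.
- by move=> j /negPf ji; rewrite !subst_atE ji.
by rewrite !subst_atE eqxx mcoeffD mcoeffZ.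
Qed.

Lemma Pbracket_alternating (x : {ffun 'I_n -> Pspace}) i j :
  i != j -> x i = x j -> Pbracket x = 0.
Proof.
move=> ij xij; rewrite /Pbracket; set S := (\bigcup_(i <- _) _)%fset.
pose s := tperm i j.
pose h (a : {ffun 'I_n -> S}) : {ffun 'I_n -> S} := [ffun k => a (s k)].
have hK : involutive h by move=> a; apply/ffunP => k; rewrite !ffunE tpermK.
set X := \sum_a _.
have : X = - X.
  rewrite {1}/X (reindex_inj (inv_inj hK)) /= -sumrN; apply: eq_bigr => a _.
  rewrite -scaleNr -mulrN; apply: bterm_eq.
  - rewrite [RHS](reindex_inj (@perm_inj _ s)) /=; apply: eq_bigr => k _.
    rewrite ffunE; congr mcoeff.
    by rewrite /s; case: tpermP => [->|->|//].
  - rewrite -[RHS]mulN1r -(expr1 (-1)).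
    have -> : (-1) ^+ 1 = (-1) ^+ (s : bool) :> K by rewrite odd_tperm ij.
    rewrite -det_perm -det_mulmx; congr (\det _).
    rewrite -row_permE; apply/matrixP => k l.
    by rewrite !mxE ffunE.
  - rewrite [RHS](reindex_inj (@perm_inj _ s)) /=; apply: eq_bigr => k _.
    by rewrite ffunE.
move/eqP; rewrite -subr_eq0 opprK -mulr2n -scaler_nat scaler_eq0 pnatr_eq0 /=.
by move/eqP.
Qed.

Lemma Pbracket_basis (a : {ffun 'I_n -> Lambda}) :
  Pbracket [ffun i => << a i >>] =
  \det (\matrix_(i < n) val (a i)) *: Pu (\sum_(i < n) val (a i) + t).
Proof.
pose S := (\bigcup_(i <- enum 'I_n) [fset a i])%fset.
have aS i : a i \in S by apply/bigfcupP; exists i; rewrite ?mem_enum ?inE.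
rewrite (@PbracketE S); last by move=> i; rewrite ffunE msuppU oner_eq0 fsub1set.
rewrite (bigD1 [ffun i => [` aS i]%fset]) //= big1 ?addr0; last first.
  move=> b bn.
  have [i hi] : exists i, val (b i) != a i.
    apply/existsP; rewrite -negb_forall; apply: contra bn => /forallP h.
    by apply/eqP/ffunP => i; rewrite ffunE; apply: val_inj; apply/eqP/h.
  by rewrite /bterm (bigD1 i) //= ffunE mcoeffU eq_sym (negPf hi) !mul0r scale0r.
rewrite -[\det _ in RHS]mul1r; apply: bterm_eq.
- by rewrite big1 // => i _; rewrite !ffunE mcoeffUU.
- by congr (\det _); apply/matrixP => k l; rewrite !mxE ffunE.
- by apply: eq_bigr => i _; rewrite ffunE.
Qed.

Lemma malg_ind (Q : Pspace -> Prop) : Q 0 ->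
  (forall c (k : Lambda) z, Q << k >> -> Q z -> Q (c *: << k >> + z)) ->
  (forall k : Lambda, Q << k >>) -> forall z, Q z.
Proof.
move=> Q0 QD Qb z; rewrite [z]monalgE; elim: (finmap.enum_fset _) => [|k s IH].
  by rewrite big_nil.
rewrite big_cons.
have -> : << z@_k *g k >> = z@_k *: << k >> :> Pspace.
  move: (z@_k) => c; apply/malgP => l.
  by rewrite [LHS]mcoeffU [RHS]mcoeffZ mcoeffU mulr_natr.
exact: QD.
Qed.

Lemma ffun_ind (D : pred 'I_n) (Q : {ffun 'I_n -> Pspace} -> Prop) :
  (forall (x : {ffun 'I_n -> Pspace}) i, D i -> Q (subst_at x i 0)) ->
  (forall (x : {ffun 'I_n -> Pspace}) i c y z, D i -> Q (subst_at x i y) -> Q (subst_at x i z) ->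
     Q (subst_at x i (c *: y + z))) ->
  (forall x : {ffun 'I_n -> Pspace}, (forall i, D i -> exists a : Lambda, x i = << a >>) -> Q x) ->
  forall x, Q x.
Proof.
move=> Q0 QD Qb x.
suff : forall m, (m <= n)%N -> forall x : {ffun 'I_n -> Pspace},
    (forall i : 'I_n, D i -> (m <= i)%N -> exists a : Lambda, x i = << a >>) -> Q x.
  by apply; first exact: leqnn; move=> i _; rewrite leqNgt ltn_ord.
elim=> [_ {}x hx|m IH mn {}x hx]; first by apply: Qb => i Di; apply: hx.
pose i := Ordinal mn.
have hb (z : Pspace) : (D i -> exists a : Lambda, z = << a >>) -> Q (subst_at x i z).
  move=> hz; apply: IH => [|j Dj mj]; first exact: ltnW.
  rewrite subst_atE; case: eqP => [ji|ji]; first by apply: hz; rewrite -ji.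
  apply: hx => //; rewrite ltn_neqAle mj andbT.
  by apply/eqP => mE; apply: ji; apply: val_inj; rewrite /= mE.
rewrite -(subst_at_id x i); have [Di|nDi] := boolP (D i); last first.
  by apply: hb => h; rewrite h in nDi.
elim/malg_ind: (x i) => [|c k z h1 h2|k]; [exact: Q0|exact: QD|].
by apply: hb; exists k.
Qed.

Local Opaque Pbracket Pu fgzero fgadd fgopp fgscale mkmalgU.

Hypothesis tH : t \in H.

Definition Phas (a : V) := (a \in H) && (a != t).

Lemma Pbracket0 x i : Pbracket (subst_at x i 0) = 0.
Proof.
have := Pbracket_linear x i 1 0 0; rewrite /= scale1r addr0 scale1r => /esym/eqP.
by rewrite -subr_eq0 addrK => /eqP.
Qed.

Lemma PbracketZ x i c z :
  Pbracket (subst_at x i (c *: z)) = c *: Pbracket (subst_at x i z).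
Proof. by rewrite -[c *: z]addr0 Pbracket_linear (Pbracket0 x i) addr0. Qed.

Lemma det_row0 (A : 'M[K]_n) (i : 'I_n) : row i A = 0 -> \det A = 0.
Proof.
move=> r0; rewrite (expand_det_row _ i) big1 // => j _.
by have := congr1 (fun v : 'rV_n => v 0 j) r0; rewrite !mxE => ->; rewrite mul0r.
Qed.

Lemma PbracketU (a : {ffun 'I_n -> V}) : (forall i, Phas (a i)) ->
  Pbracket [ffun i => Pu (a i)] =
  \det (\matrix_(i < n) a i) *: Pu (\sum_(i < n) a i + t).
Proof.
move=> ha; have [[i ai0]|no] := pselect (exists i, a i = 0).
  rewrite (@det_row0 _ i) ?rowK // scale0r -(subst_at_id [ffun i => _] i).
  by rewrite ffunE ai0 Pu_out ?eqxx ?andbF // Pbracket0.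
have hL i : [&& a i \in H, a i != 0 & a i != t].
  have /andP[-> ->] := ha i; rewrite andbT /=; apply/eqP => ai0; apply: no; by exists i.
have -> : [ffun i => Pu (a i)] = [ffun i => << [ffun i => (exist _ (a i) (hL i) : Lambda)] i >>].
  by apply/ffunP => i; rewrite !ffunE -Pu_val.
rewrite Pbracket_basis -[X in X *: _]mul1r -[X in _ = X *: _]mul1r; apply: bterm_eq => //.
- by congr (\det _); apply/matrixP => k l; rewrite !mxE ffunE.
- by apply: eq_bigr => i _; rewrite ffunE.
Qed.

Lemma PbracketUZ (a : {ffun 'I_n -> V}) i c b : (forall j, j != i -> Phas (a j)) ->
  b \in H -> (b == t -> c = 0) ->
  Pbracket (subst_at [ffun j => Pu (a j)] i (c *: Pu b)) =
  (c * \det (\matrix_(j < n) subst_at a i b j))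
    *: Pu (\sum_(j < n) subst_at a i b j + t).
Proof.
move=> ha bH bt; have [/bt->|nbt] := boolP (b == t).
  by rewrite scale0r Pbracket0 mul0r scale0r.
rewrite PbracketZ -scalerA; congr (_ *: _).
have -> : subst_at [ffun j => Pu (a j)] i (Pu b) = [ffun j => Pu (subst_at a i b j)].
  by apply/ffunP => j; rewrite !ffunE; case: eqP.
rewrite PbracketU // => j; rewrite subst_atE; case: eqP => [_|/eqP ji]; last exact: ha.
by rewrite /Phas bH nbt.
Qed.

Lemma det_subst (a : {ffun 'I_n -> V}) i v :
  \det (\matrix_(j < n) subst_at a i v j) = (v *m \adj (\matrix_(j < n) a j)) 0 i.
Proof.
rewrite (expand_det_row _ i) mxE; apply: eq_bigr => k _; rewrite !mxE subst_atE eqxx.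
congr (_ * _); rewrite /cofactor; congr (_ * \det _); apply/matrixP => p q.
by rewrite !mxE subst_atE eq_sym (negPf (neq_lift _ _)).
Qed.

Lemma det_sum0 (a : {ffun 'I_n -> V}) : (0 < n)%N ->
  \sum_(i < n) a i = 0 -> \det (\matrix_(i < n) a i) = 0.
Proof.
move=> n0 s0; apply/eqP/negPn/negP => d0.
have uM : \matrix_(i < n) a i \in unitmx by rewrite unitmxE unitfE.
have : (const_mx 1 : V) *m (\matrix_(i < n) a i) = 0.
  rewrite -s0 mulmx_sum_row; apply: eq_bigr => i _.
  by rewrite rowK mxE scale1r.
move/(congr1 (fun v => v *m invmx (\matrix_(i < n) a i))).
rewrite mulmxK // mul0mx => /matrixP/(_ 0 (Ordinal n0)); rewrite !mxE.
by move/eqP; rewrite oner_eq0.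
Qed.

Lemma sum_subst (a : {ffun 'I_n -> V}) i v :
  \sum_j subst_at a i v j = v + \sum_(j | j != i) a j.
Proof.
rewrite (bigD1 i) //= subst_atE eqxx; congr (_ + _).
by apply: eq_bigr => j /negPf ji; rewrite subst_atE ji.
Qed.

Lemma det_jacobi (a b : {ffun 'I_n -> V}) (l : 'I_n) :
  \det (\matrix_(j < n) b j) *
    \det (\matrix_(j < n) subst_at a l (\sum_j b j + t) j) =
  \sum_(i < n) \det (\matrix_(j < n) subst_at a l (b i) j) *
    \det (\matrix_(j < n) subst_at b i (b i + (\sum_(j | j != l) a j) + t) j).
Proof.
set A := \sum_(j | j != l) a j; set B := \matrix_(j < n) b j; set N := \matrix_(j < n) a j.
pose phi (v : V) := (v *m \adj N) 0 l.
have phiE v : \det (\matrix_(j < n) subst_at a l v j) = phi v by exact: det_subst.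
have phiD : {morph phi : v w / v + w} by move=> v w; rewrite /phi mulmxDl mxE.
have phiZ c v : phi (c *: v) = c * phi v by rewrite /phi -scalemxAl mxE.
have phi0 : phi 0 = 0 by rewrite /phi mul0mx mxE.
have phi_sum (P : pred 'I_n) F : phi (\sum_(i | P i) F i) = \sum_(i | P i) phi (F i).
  exact: (big_morph phi phiD phi0).
have phiA : phi A = 0.
  rewrite phi_sum big1 // => j jl; have := congr1 (fun M : 'M_n => M j l) (mul_mx_adj N).
  rewrite [RHS]mxE (negPf jl) mulr0n => <-.
  by rewrite /phi !mxE; apply: eq_bigr => k _; rewrite !mxE.
have bE i : (b i *m \adj B) 0 i = \det B.
  have := congr1 (fun M : 'M_n => M i i) (mul_mx_adj B).
  rewrite [RHS]mxE eqxx mulr1n => <-.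
  by rewrite !mxE; apply: eq_bigr => k _; rewrite !mxE.
rewrite phiE phiD phi_sum.
transitivity (\sum_(i < n) (\det B * phi (b i) +
    phi (((A + t) *m \adj B) 0 i *: b i))); last first.
  apply: eq_bigr => i _; rewrite phiE det_subst -/B -addrA (mulmxDl (b i)) [in RHS]mxE bE phiZ.
  by rewrite mulrDr (mulrC (phi _)) (mulrC (phi _) (_ 0 i)).
rewrite big_split /= -mulr_sumr mulrDr; congr (_ + _); rewrite -phi_sum.
have -> : \sum_(i < n) ((A + t) *m \adj B) 0 i *: b i = \det B *: (A + t).
  rewrite -mul_mx_scalar -mul_adj_mx mulmxA [RHS]mulmx_sum_row.
  by apply: eq_bigr => i _; rewrite rowK.
by rewrite phiZ phiD phiA add0r.
Qed.

Lemma Pbracket_n0 x : n = 0%N -> Pbracket x = 0.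
Proof.
move=> n0; have no (i : 'I_n) : False by have := leq_ltn_trans (leq0n i) (ltn_ord i); rewrite n0.
have -> : x = [ffun i => Pu ([ffun=> 0] i)] by apply/ffunP => i; case: (no i).
rewrite PbracketU; last by move=> i; case: (no i).
rewrite big1 ?add0r; last by move=> i; case: (no i).
by rewrite Pu_out ?eqxx ?andbF // scaler0.
Qed.

Lemma Pbracket_jacobi (x y : {ffun 'I_n -> Pspace}) :
  Pbracket (subst_last x (Pbracket y)) =
  \sum_(i < n) Pbracket (subst_at y i (Pbracket (subst_last x (y i)))).
Proof.
have [n0|n0] := posnP n.
  rewrite Pbracket_n0 // big1 // => i _; exact: Pbracket_n0.
have ln : (n.-1 < n)%N by rewrite ltn_predL.
pose l := Ordinal ln.
have lastE (z : {ffun 'I_n -> Pspace}) w : subst_last z w = subst_at z l w.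
  apply/ffunP => j; rewrite !ffunE; congr (if _ then _ else _).
  by rewrite -[RHS]val_eqE /= -[RHS]eqSS [X in _ = (_ == X)](prednK n0).
rewrite lastE; under eq_bigr => i _ do rewrite lastE.
move: x y; apply: (@ffun_ind (fun i => i != l)).
- move=> x i il y; rewrite subst_atC // Pbracket0 big1 // => j _.
  by rewrite (subst_atC x) // Pbracket0 Pbracket0.
- move=> x i c u v il hu hv y; rewrite subst_atC // Pbracket_linear.
  rewrite -!(subst_atC x _ _ il) hu hv scaler_sumr -big_split /=.
  apply: eq_bigr => j _; rewrite !(subst_atC x _ _ il) (Pbracket_linear (subst_at x l (y j))).
  by rewrite Pbracket_linear.
move=> x hx.
have basisE (z : Pspace) : (exists k : Lambda, z = << k >>) ->
    exists v : V, Phas v /\ z = Pu v.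
  move=> [k ->]; exists (val k); rewrite Pu_val; split=> //.
  by have /and3P[k1 k2 k3] := valP k; rewrite /Phas k1.
have [a0 ha0] : exists a : 'I_n -> V, forall i, i != l -> Phas (a i) /\ x i = Pu (a i).
  apply: (@fin_all_exists _ (fun=> V) (fun i v => i != l -> Phas v /\ x i = Pu v)) => i.
  by have [il|/hx/basisE[v hv]] := eqVneq i l; [exists 0 | exists v].
pose a := [ffun i => a0 i].
have ha i : i != l -> Phas (a i) by move=> /ha0[h _]; rewrite ffunE.
pose ad z := Pbracket (subst_at [ffun i => Pu (a i)] l z).
have adE z : Pbracket (subst_at x l z) = ad z.
  congr Pbracket; apply/ffunP => i; rewrite !ffunE; case: eqP => // /eqP il.
  by have [_ ->] := ha0 _ il.
have ad0 : ad 0 = 0 by exact: Pbracket0.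
have adD c z w : ad (c *: z + w) = c *: ad z + ad w by exact: Pbracket_linear.
move=> y; rewrite adE; under eq_bigr => i _ do rewrite adE.
move: y; apply: (@ffun_ind predT).
- move=> y i _; rewrite Pbracket0 ad0 big1 // => j _.
  rewrite subst_atE; case: eqP => [->|/eqP ji]; first by rewrite ad0 Pbracket0.
  by rewrite subst_atC 1?eq_sym // Pbracket0.
- move=> y i c z w _ hz hw; rewrite Pbracket_linear adD hz hw scaler_sumr -big_split /=.
  apply: eq_bigr => j _; rewrite !subst_atE; case: eqP => [->|/eqP ji].
    by rewrite adD !subst_at2 Pbracket_linear.
  by rewrite !(subst_atC y _ _ (_ : i != j)) 1?eq_sym // Pbracket_linear.
move=> y hy.
have [b0 hb0] : exists b : 'I_n -> V, forall i, Phas (b i) /\ y i = Pu (b i).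
  apply: (@fin_all_exists _ (fun=> V) (fun i v => Phas v /\ y i = Pu v)) => i.
  exact/basisE/hy.
pose b := [ffun i => b0 i].
have hb i : Phas (b i) by rewrite ffunE; case: (hb0 i).
have -> : y = [ffun i => Pu (b i)].
  by apply/ffunP => i; rewrite !ffunE; case: (hb0 i).
have bH i : b i \in H by case/andP: (hb i).
have aH i : i != l -> a i \in H by case/ha/andP.
set A := \sum_(j | j != l) a j.
have AH : A \in H by apply: rpred_sum.
have dett (c : {ffun 'I_n -> V}) : \sum_i c i + t == t ->
    \det (\matrix_(j < n) c j) = 0.
  by rewrite -subr_eq0 addrK => /eqP; apply: det_sum0.
rewrite PbracketU // /ad PbracketUZ //; last first.
- exact: dett.
- by rewrite rpredD // rpred_sum.
rewrite det_jacobi scaler_suml; apply: eq_bigr => i _.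
have -> : [ffun k => Pu (b k)] i = 1 *: Pu (b i) by rewrite ffunE scale1r.
rewrite PbracketUZ //; last first.
  by case/andP: (hb i) => _ /negPf ->.
rewrite mul1r.
rewrite (PbracketUZ (a := b)); last first.
- exact: dett.
- by rewrite sum_subst -/A !rpredD.
- by move=> j _; apply: hb.
rewrite !sum_subst -/A; congr (_ *: Pu _).
by rewrite [\sum_j b j](bigD1 i) //= [LHS](ACl (1*4*3*2*5)).
Qed.

Definition P : nLieAlgebra K n :=
  NLieAlgebra Pbracket_linear Pbracket_alternating Pbracket_jacobi.
End PHt.

Arguments P {K n} H t tH.

(* Main.v *)
(** Let [f_d a] be the coefficient of [u_(a + d)] in [T u_a].  Comparing the
    coefficients of [u_(s + t + d)], where [s = x_1 + ... + x_n], in the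
    derivation identity gives, as long as [s + t + d] is in [Lambda],
      [\sum_i f_d x_i * det(x_1, ..., x_i + d, ..., x_n)
         = n * f_d (s + t) * det(x_1, ..., x_n)].

    For [d != 0], dependent families show that [f_d] is linear on vectors
    that together with [d] are independent.
    Replacing [a] by [j a] in a basis [(j d, a, j b_2, b_3, ...)] moves [s] by
    [(j - 1) a], so [n (j - 1) f_d a = (j - 1) f_d a] and [f_d a = 0] off the
    line of [d]; on the line one more basis suffices.  For [d = 0],
    adding [a] to different members of a basis gives the same [s], so the
    increment of [f_0] along [a] does not depend on the base point; being also
    [n] times the increment at [s + t], it vanishes, and [f_0] is constant. *)
From HB Require Import structures.
Require Import Defs.
From mathcomp Require Import all_boot all_order all_algebra.
From mathcomp Require Import classical_sets reals complex.
From mathcomp Require Import boolp monalg ring.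
Import GRing.Theory Num.Theory.
Local Open Scope ring_scope.

Set Implicit Arguments.
Unset Strict Implicit.
Unset Printing Implicit Defensive.

(** * Determinants and sums under replacement of a row *)

Section RowReplacement.
Variables (K : numFieldType) (n : nat).
Local Notation V := 'rV[K]_n.
Implicit Types (x b : {ffun 'I_n -> V}) (i k l : 'I_n) (u v w : V).

Definition det_rows x := \det (\matrix_i x i).
Definition det_at x i v := det_rows (subst_at x i v).

Lemma det_at_linear x i : linear_for *%R (det_at x i).
Proof.
by move=> c u v; rewrite /det_at /det_rows !det_subst mulmxDl -scalemxAl !mxE.
Qed.

HB.instance Definition _ x i :=
  GRing.isLinear.Build K V K *%R (det_at x i) (det_at_linear x i).

Lemma det_at_id x i : det_at x i (x i) = det_rows x.
Proof. by rewrite /det_at subst_at_id. Qed.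

Lemma det_rows_alternate x i k : i != k -> x i = x k -> det_rows x = 0.
Proof.
move=> ik xik; apply: (determinant_alternate ik) => j.
by rewrite !mxE xik.
Qed.

Lemma det_at_row x i k : i != k -> det_at x i (x k) = 0.
Proof.
move=> ik; apply: (@det_rows_alternate _ i k) => //.
by rewrite !subst_atE eqxx eq_sym (negPf ik).
Qed.

Lemma det_at_sum x i : det_at x i (\sum_k x k) = det_rows x.
Proof.
rewrite raddf_sum (bigD1 i) //= det_at_id big1 ?addr0 // => k ki.
by rewrite det_at_row // eq_sym.
Qed.

Lemma det_rows_neq0 x i : det_rows x != 0 -> x i != 0.
Proof. by move=> D0; apply: contra_neq D0 => xi; rewrite -(det_at_id x i) xi raddf0. Qed.

Lemma det_rows_shear x i k c :
  i != k -> det_rows (subst_at x i (x i + c *: x k)) = det_rows x.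
Proof.
by move=> ik; rewrite -/(det_at _ _ _) raddfD /= linearZ /= det_at_id det_at_row // mulr0 addr0.
Qed.

(** Polarization: the determinant with [u + v] in both rows vanishes, and so do its two pure
    terms. *)
Lemma det_at_swap x i k u v : i != k ->
  det_at (subst_at x i u) k v = - det_at (subst_at x i v) k u.
Proof.
move=> ik; apply/eqP; rewrite -addr_eq0.
have ki : k != i by rewrite eq_sym.
have alt w : det_at (subst_at x i w) k w = 0.
  by apply: (@det_rows_alternate _ i k) => //; rewrite !subst_atE !eqxx (negPf ik).
have at_i w z : det_at (subst_at x i w) k z = det_at (subst_at x k z) i w.
  by rewrite /det_at subst_atC.
have := alt (u + v).
rewrite raddfD /= !at_i !raddfD /= -!at_i !alt add0r addr0 addrC => ->.
by [].
Qed.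

Lemma det_at_scale x i k c v : i != k ->
  det_at (subst_at x i (c *: x i)) k v = c * det_at x k v.
Proof.
move=> ik; rewrite /det_at subst_atC // -/(det_at _ i _).
have -> : x i = subst_at x k v i by rewrite subst_atE (negPf ik).
by rewrite linearZ /= det_at_id.
Qed.

(** Taking [g] to be the identity gives the sum of the new family; taking [g] to be a coefficient
    function [f] gives the sum of its values. *)
Lemma sum_subst_at (U : zmodType) (g : V -> U) x i v :
  \sum_k g (subst_at x i v k) = \sum_k g (x k) + (g v - g (x i)).
Proof.
rewrite (bigD1 i) //= subst_atE eqxx [in RHS](bigD1 i) //=.
rewrite [RHS]addrC -addrA addKr; congr (_ + _); apply: eq_bigr => k /negPf ki.
by rewrite subst_atE ki.
Qed.

Lemma sum_subst_other x i k v : k != i ->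
  \sum_(l | l != k) subst_at x i v l = \sum_l x l - x k + (v - x i).
Proof.
move=> /negPf ki; have := @sum_subst_at _ id x i v.
rewrite (bigD1 k) //= subst_atE ki => e; apply: (addrI (x k)).
by apply: (etrans e); rewrite -!addrA [RHS]addrCA addNKr.
Qed.

End RowReplacement.

(** * Meeting finitely many conditions by one large integer *)

Section Eventually.

Definition evt (P : pred nat) := exists N, forall j, (N <= j)%N -> P j.

Lemma evt_and P Q : evt P -> evt Q -> evt [pred j | P j && Q j].
Proof.
move=> [M hM] [N hN]; exists (maxn M N) => j; rewrite geq_max => /andP[/hM ? /hN ?].
exact/andP.
Qed.

Lemma evt_gt N : evt [pred j | N < j]%N.
Proof. by exists N.+1. Qed.

(** In characteristic zero the multiples of a nonzero [v] are distinct, so at most one of them is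
    [w]. *)
Lemma evt_scale (K : numFieldType) (U : lmodType K) (v w : U) :
  v != 0 -> evt [pred j | j%:R *: v != w].
Proof.
move=> v0; have [[N hN]|no] := pselect (exists N, N%:R *: v = w).
  exists N.+1 => j Nj /=; rewrite -hN -subr_eq0 -scalerBl scaler_eq0 negb_or v0.
  by rewrite subr_eq0 eqr_nat (gtn_eqF Nj).
by exists 0%N => j _ /=; apply/eqP => jv; apply: no; exists j.
Qed.

Lemma evt_affine (K : numFieldType) (p q : K) :
  p != 0 -> evt [pred j | j%:R * p + q != 0].
Proof.
move=> p0; have [N hN] := @evt_scale K K^o p (- q) p0.
by exists N => j /hN /=; rewrite -addr_eq0.
Qed.

End Eventually.

(** * Bases of the space consisting of vectors of [H] *)

Section SpanningSubgroup.
Variables (K : numFieldType) (n : nat) (H : zmodClosed 'rV[K]_n).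
Hypothesis H_spans : forall v, in_span H v.
Variables (t : 'rV[K]_n) (tH : t \in H) (t0 : t != 0).
Local Notation V := 'rV[K]_n.

(** The span of [s] is a proper subspace, so it cannot contain the spanning set [H]. *)
Lemma free_extend (s : seq V) : free s -> (size s < n)%N ->
  exists h, [/\ h \in H, h != t & free (h :: s)].
Proof.
move=> fs sn.
have [h hH hs] : exists2 h, h \in H & h \notin <<s>>%VS.
  apply: contrapT => no.
  have all_in h : h \in H -> h \in <<s>>%VS.
    by move=> hH; apply/negPn/negP => hs; apply: no; exists h.
  have : (fullv <= <<s>>)%VS.
    apply/subvP => v _; have [r rH vr] := H_spans v.
    by apply: subvP vr; apply/span_subvP => w /rH; apply: all_in.
  move/dimvS; rewrite dimvf /dim /= mul1n => nd.
  by have := leq_trans nd (dim_span s); rewrite leqNgt sn.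
have [ht|ht] := eqVneq h t; last by exists h; rewrite free_cons hs fs.
(* If the vector found is [t] itself, its double still lies in [H] and off the span, and differs
   from [t] because [t != 0]. *)
exists (2%:R *: t); split.
- by rewrite scaler_nat rpredMn.
- by rewrite scaler_nat mulr2n -subr_eq0 addrK.
- rewrite free_cons fs andbT; apply: contra hs => /(memvZ 2%:R^-1).
  by rewrite scalerA mulVf ?pnatr_eq0 // scale1r ht.
Qed.

Lemma free_complete (s : seq V) : free s -> (size s <= n)%N ->
  exists r, [/\ {in r, forall v, (v \in H) && (v != t)}, size (r ++ s) = n & free (r ++ s)].
Proof.
move=> fs sn.
(* Induction on a bound for the number of missing vectors. *)
suff [m] : exists m, (n - size s <= m)%N.
  elim: m s fs sn => [|m IH] s fs sn nm.
    exists [::]; split=> //; apply/eqP; rewrite eqn_leq sn /=.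
    by rewrite -subn_eq0 -leqn0.
  have [sn'|ns] := ltnP (size s) n; last first.
    by exists [::]; split=> //; apply/eqP; rewrite eqn_leq sn ns.
  have [h [hH ht fhs]] := free_extend fs sn'.
  have [|r [rH rs fr]] := IH (h :: s) fhs sn'.
    by rewrite /= subnS; case: (n - size s)%N nm.
  exists (rcons r h); split; rewrite ?cat_rcons // => v.
  by rewrite mem_rcons inE => /predU1P[-> | /rH //]; rewrite hH.
by exists (n - size s)%N.
Qed.

(** A nonzero vector in the left kernel would be a linear relation between the rows. *)
Lemma det_rows_free (s : seq V) : free s -> size s = n ->
  det_rows [ffun i : 'I_n => s`_i] != 0.
Proof.
move=> + sn; move: s sn => /= s /eqP sn; rewrite -[s]/(tval (Tuple sn)).
move: (Tuple sn) => {sn}s /freeP fs.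
apply/det0P => -[v v0 vM]; case/negP: v0; apply/eqP/rowP => i; rewrite mxE.
apply: (fs (v 0)); rewrite -[RHS]vM mulmx_sum_row; apply: eq_bigr => j _.
by rewrite rowK ffunE.
Qed.

Lemma basis_complete (s : seq V) : free s -> {subset s <= H} -> (size s <= n)%N ->
  exists b : {ffun 'I_n -> V}, [/\ forall i : 'I_n, (i < size s)%N -> b i = s`_i,
    det_rows b != 0, forall i, b i \in H & forall i : 'I_n, (size s <= i)%N -> b i != t].
Proof.
move=> fs sH sn; have [r [rH rs fr]] := free_complete fs sn.
have fsr : free (s ++ r) by rewrite (perm_free (permEl (perm_catC s r))).
have srn : size (s ++ r) = n by rewrite size_cat addnC -size_cat.
exists [ffun i : 'I_n => (s ++ r)`_i]; split.
- by move=> i si; rewrite ffunE nth_cat si.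
- exact: det_rows_free.
- move=> i; rewrite ffunE.
  have : (s ++ r)`_i \in s ++ r by rewrite mem_nth // srn.
  by rewrite mem_cat => /orP[/sH | /rH/andP[]].
- move=> i si; rewrite ffunE nth_cat ltnNge si /=.
  have /rH/andP[//] : r`_(i - size s) \in r.
  by apply: mem_nth; rewrite -(ltn_add2l (size s)) subnKC // -size_cat srn.
Qed.

End SpanningSubgroup.

(** * Coefficients of brackets and of the map [T] *)

Section Coefficients.
Variables (K : numFieldType) (n : nat) (H : zmodClosed 'rV[K]_n) (t : 'rV[K]_n).
Hypothesis tH : t \in H.
Local Notation V := 'rV[K]_n.
Local Notation Pspace := {malg K[Lambda H t]}.
Implicit Types (e v w : V) (z : Pspace) (x : {ffun 'I_n -> V}).

Definition in_Lambda v := [&& v \in H, v != 0 & v != t].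

(** The extension by zero allows any vector as an index, so that shifted indices such as [a + d]
    need no membership proof. *)
Definition coefu v z : K := if insub v is Some k then mcoeff (k : Lambda H t) z else 0.

Lemma coefu_linear v : linear_for *%R (coefu v).
Proof.
move=> c z w; rewrite /coefu; case: insub => [k|]; last by rewrite mulr0 addr0.
by rewrite [mcoeff _ _ in LHS]mcoeffD mcoeffZ.
Qed.

HB.instance Definition _ v := GRing.isLinear.Build K Pspace K *%R (coefu v) (coefu_linear v).

Lemma coefu_Pu v w : in_Lambda v -> coefu v (Pu H t w) = (v == w)%:R.
Proof.
move=> vL; rewrite /coefu insubT /Pu; case: insubP => [k _ <-|wN]; last first.
  by rewrite mcoeff0; have [vw|//] := eqVneq v w; rewrite -vw -/(in_Lambda v) vL in wN.
by rewrite mcoeffU eq_sym -val_eqE.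
Qed.

Lemma coefu_notin v z : ~~ in_Lambda v -> coefu v z = 0.
Proof. by move=> vN; rewrite /coefu insubN. Qed.

Lemma coefuE (k : Lambda H t) z : mcoeff k z = coefu (val k) z.
Proof. by rewrite /coefu valK. Qed.

Local Opaque Pbracket Pu fgzero fgadd fgopp fgscale mkmalgU.

(** With basis vectors in all other slots, the index [e] is reached from exactly one index in slot
    [i]. By linearity in [z] it suffices to check this on basis vectors. *)
Lemma coefu_bracket x i e z : (forall j, in_Lambda (x j)) -> in_Lambda e ->
  coefu e (Pbracket (subst_at [ffun j => Pu H t (x j)] i z)) =
  det_at x i (e - t - \sum_(j | j != i) x j) * coefu (e - t - \sum_(j | j != i) x j) z.
Proof.
move=> xL eL; set v := e - t - _.
have Hunit (k : Lambda H t) : coefu e (Pbracket (subst_at [ffun j => Pu H t (x j)] i << k >>)) =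
    det_at x i v * coefu v << k >>.
  have kL : in_Lambda (val k) := valP k.
  have /and3P[kH k0 kt] := kL.
  rewrite -Pu_val -[Pu _ _ _ in LHS]scale1r PbracketUZ //; last 2 first.
  - by move=> j _; have /and3P[? ? ?] := xL j; apply/andP.
  - by rewrite (negPf kt).
  rewrite mul1r -/(det_rows _) -/(det_at _ _ _) linearZ /= coefu_Pu // sum_subst.
  have -> : (e == val k + \sum_(j | j != i) x j + t) = (val k == v).
    by rewrite /v [RHS]eq_sym !subr_eq.
  have [<-|kv] := eqVneq (val k) v; first by rewrite coefu_Pu ?eqxx ?kL.
  (* Here [val k != v] kills the left side; on the right, a [v] outside [Lambda] gives the default
     value zero. *)
  have [vL|vN] := boolP (in_Lambda v); last by rewrite coefu_notin // !mulr0.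
  by rewrite coefu_Pu // eq_sym (negPf kv) !mulr0.
elim/malg_ind: z => [|c k y hk hy|k]; last exact: Hunit.
- by rewrite Pbracket0 !raddf0 mulr0.
- by rewrite Pbracket_linear !linearP /= hk hy; ring.
Qed.

Variable T : Pspace -> Pspace.
Hypothesis T_linear : linear T.
Hypothesis T_der : forall x : {ffun 'I_n -> Pspace},
  \sum_(i < n) Pbracket (subst_at x i (T (x i))) = T (Pbracket x) *+ n.

Definition shift_coef d a := coefu (a + d) (T (Pu H t a)).

Let T0 : T 0 = 0.
Proof. by have := T_linear (-1) 0 0; rewrite scaler0 addr0 scaleN1r addNr. Qed.

(** In slot [i] the only index contributing to the coefficient at [\sum_i x i + t + d] is
    [x i + d]. *)
Lemma shift_coef_identity d x :
  (forall j, in_Lambda (x j)) -> in_Lambda (\sum_i x i + t + d) ->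
  \sum_i shift_coef d (x i) * det_at x i (x i + d) =
  shift_coef d (\sum_i x i + t) * det_rows x *+ n.
Proof.
move=> xL eL; have TZ c z : T (c *: z) = c *: T z.
  by rewrite -[c *: z]addr0 T_linear T0 addr0.
have := congr1 (coefu (\sum_i x i + t + d)) (T_der [ffun i => Pu H t (x i)]).
rewrite PbracketU; last by move=> j; have /and3P[? ? ?] := xL j; apply/andP.
rewrite TZ => E; have {}E : coefu (\sum_i x i + t + d) (\sum_i Pbracket
    (subst_at [ffun i => Pu H t (x i)] i (T ([ffun i => Pu H t (x i)] i)))) =
    shift_coef d (\sum_i x i + t) * det_rows x *+ n.
  by rewrite E raddfMn /= linearZ /= mulrC.
rewrite -{}E raddf_sum; apply: eq_bigr => i _ /=.
rewrite coefu_bracket // ffunE.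
suff -> : \sum_j x j + t + d - t - \sum_(j | j != i) x j = x i + d by rewrite mulrC.
by rewrite (bigD1 i) //= (addrAC (_ + t) d) addrK addrAC addrK.
Qed.

End Coefficients.

(** * Vanishing for nonzero shifts, constancy for the zero shift *)

Section ShiftCoefficients.
Variables (K : numFieldType) (m : nat).
Local Notation n := m.+3.
Variables (H : zmodClosed 'rV[K]_n) (t : 'rV[K]_n).
Hypotheses (H_spans : forall v, in_span H v) (tH : t \in H) (t0 : t != 0).
Local Notation V := 'rV[K]_n.
Local Notation inL := (in_Lambda H t).
Implicit Types (v w a : V) (b x : {ffun 'I_n -> V}).

(** Two linear functionals certify membership: one separates [v] from [0], the other separates it
    from [t]. All later sums are placed in [Lambda] this way. *)
Lemma in_Lambda_det b i k v : v \in H -> det_at b i v != 0 ->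
  det_at b k (v - t) != 0 -> inL v.
Proof.
move=> vH vi vk; apply/and3P; split=> //; first by apply: contra_neq vi => ->; rewrite raddf0.
by apply: contra_neq vk => ->; rewrite subrr raddf0.
Qed.

Lemma free2P a v : reflect (a != 0 /\ v \notin <[a]>%VS) (free [:: v; a]).
Proof. by rewrite free_cons span_seq1 free_cons span_nil memv0 nil_free andbT; apply: (iffP andP) => -[]. Qed.

Lemma free2_det b i a v : a != 0 -> det_at b i a = 0 -> det_at b i v != 0 -> free [:: a; v].
Proof.
move=> a0 ai vi; rewrite (perm_free (permEl (perm_catC [:: a] [:: v]))).
apply/free2P; split=> //; apply: contra_neqN vi => /vlineP[c ->].
by rewrite linearZ /= ai mulr0.
Qed.

Variables (d : V) (f : V -> K).
Hypothesis dH : d \in H.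
Hypothesis f_id : forall x, (forall j, inL (x j)) -> inL (\sum_i x i + t + d) ->
  \sum_i f (x i) * det_at x i (x i + d) = f (\sum_i x i + t) * det_rows x *+ n.

(** When [d] is a multiple of row [k], adding it to another row is a shear, while adding it to row
    [k] multiplies the determinant by [1 + c]. The common determinant is then cancelled in
    [f_id]. *)
Lemma average_of_basis x k c : (forall j, inL (x j)) -> det_rows x != 0 ->
  d = c *: x k -> inL (\sum_i x i + t + d) ->
  f (\sum_i x i + t) *+ n = \sum_i f (x i) + c * f (x k).
Proof.
move=> xL D0 dE eL; apply: (mulIf D0); rewrite mulrnAl -f_id //.
rewrite mulrDl mulr_suml (bigD1 k) //= [in RHS](bigD1 k) //= dE.
rewrite [in LHS]raddfD /= linearZ /= det_at_id.
have -> : \sum_(i | i != k) f (x i) * det_at x i (x i + c *: x k) =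
   \sum_(i | i != k) f (x i) * det_rows x.
  by apply: eq_bigr => i ik; rewrite raddfD /= linearZ /= det_at_id det_at_row // mulr0 addr0.
by ring.
Qed.

(* With [w] the combination of [b i] and [b j], substituting [w] for [b k = d]
   gives a dependent family, which kills the right-hand side of [f_id]. *)
Lemma additive_modulo_shift b k i j p q : k != i -> k != j -> i != j ->
  b k = d -> det_rows b != 0 -> (forall l, l != k -> inL (b l)) ->
  inL (p *: b i + q *: b j) ->
  inL (p *: b i + q *: b j + \sum_(l | l != k) b l + t + d) ->
  f (p *: b i + q *: b j) = p * f (b i) + q * f (b j).
Proof.
move=> ki kj ij bk D0 bL; set w := _ + _ => wL eL.
pose x := subst_at b k w.
have wE l : det_at b l w = p * (det_rows b *+ (l == i)) + q * (det_rows b *+ (l == j)).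
  rewrite raddfD /= !linearZ /=; congr (_ * _ + _ * _).
    by case: eqP => [->|/eqP li]; rewrite ?det_at_id ?det_at_row.
  by case: eqP => [->|/eqP lj]; rewrite ?det_at_id ?det_at_row.
have x0 : det_rows x = 0.
  by rewrite -/(det_at _ _ _) wE (negPf ki) (negPf kj) !mulr0n !mulr0 addr0.
have xk v : det_at x k v = det_at b k v by rewrite /det_at subst_at2.
have xL l : inL (x l) by rewrite subst_atE; case: eqP => // /eqP; apply: bL.
have := f_id xL; rewrite sum_subst x0 mulr0 mul0rn => /(_ eL).
(* In slot [k] the dependent row [w] contributes nothing and [d] restores [b]. *)
have e0 : det_at x k (x k + d) = det_rows b.
  by rewrite raddfD /= det_at_id x0 add0r xk -bk det_at_id.
rewrite (bigD1 k) //= e0 {1}/x subst_atE eqxx.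
(* For [l != k], exchanging rows [k] and [l] puts [d] back in row [k], at the price of a sign. *)
rewrite (eq_bigr (fun l => - (f (b l) * det_at b l w))); last first.
  move=> l lk; rewrite raddfD /= det_at_id x0 add0r det_at_swap 1?eq_sym //.
  by rewrite -{1}bk subst_at_id mulrN subst_atE (negPf lk).
rewrite sumrN => /eqP; rewrite subr_eq0 => /eqP.
rewrite (bigD1 i) 1?eq_sym //= (bigD1 j) /=; last by rewrite eq_sym kj eq_sym.
rewrite big1 => [|l /andP[/andP[_ li] lj]]; last first.
  by rewrite wE (negPf li) (negPf lj) !mulr0n !mulr0 addr0 mulr0.
rewrite !wE !eqxx (negPf ij) [j == i]eq_sym (negPf ij) !mulr0n !mulr1n => e.
by apply: (mulIf D0); rewrite e; ring.
Qed.

Local Notation i0 := (ord0 : 'I_n).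
Local Notation i1 := (@Ordinal n 1 isT).
Local Notation i2 := (@Ordinal n 2 isT).

Lemma ord_case3 (P : 'I_n -> Prop) :
  P i0 -> P i1 -> P i2 -> (forall i, i != i0 -> i != i1 -> i != i2 -> P i) -> forall i, P i.
Proof.
move=> P0 P1 P2 Pi i.
have [->//|h0] := eqVneq i i0; have [->//|h1] := eqVneq i i1; have [->//|h2] := eqVneq i i2.
exact: Pi.
Qed.

(** The prescribed [a] and [v] may equal [t]; only the members added to them are chosen different
    from it. *)
Lemma lattice_basis a v : free [:: a; v] -> a \in H -> v \in H ->
  exists b, [/\ b i0 = a, b i1 = v, det_rows b != 0, forall i, b i \in H &
    forall i, i != i0 -> i != i1 -> b i != t].
Proof.
move=> fav aH vH; have [||b [bE b_free bH bt]] := basis_complete H_spans tH t0 fav.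
- by move=> w; rewrite !inE => /orP[] /eqP ->.
- by [].
exists b; split=> //; [exact: bE|exact: bE|].
by move=> [[|[|i]] hi] // _ _; apply: bt.
Qed.

(* The factor [j] in position [i2] is the free parameter that keeps all the sums
   occurring below away from the excluded values [0] and [t]. *)
Definition stretch b (v : V) j := subst_at (subst_at b i0 v) i2 (j%:R *: b i2).

Lemma stretch_sum b v j : \sum_i stretch b v j i =
  \sum_i b i + (v - b i0) + (j%:R *: b i2 - b i2).
Proof. by rewrite /stretch !(@sum_subst_at _ _ _ id) subst_atE. Qed.

Lemma stretch_det b c j : det_rows (stretch b (c *: b i0) j) = c * j%:R * det_rows b.
Proof.
rewrite -[det_rows _ in LHS]/(det_at _ _ _) det_at_scale // linearZ /= det_at_id.
by rewrite mulrA.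
Qed.

(** The nonzero determinant already makes every row nonzero, which leaves membership in [H] and the
    comparison with [t]. *)
Lemma stretch_in_Lambda b c j : (forall i, b i \in H) ->
  (forall i, i != i0 -> i != i1 -> b i != t) -> b i1 != t ->
  c *: b i0 \in H -> c *: b i0 != t -> j%:R *: b i2 != t ->
  det_rows (stretch b (c *: b i0) j) != 0 ->
  forall i, inL (stretch b (c *: b i0) j i).
Proof.
move=> bH bt b1 cH ct jt D0 i; apply/and3P; split; last 2 first.
- exact: det_rows_neq0.
- by move: i; apply: ord_case3 => [|||i h0 h1 h2]; rewrite !subst_atE //= ?(negPf h0) ?(negPf h2) ?bt.
- by move: i; apply: ord_case3 => [|||i h0 h1 h2]; rewrite !subst_atE //= ?(negPf h0) ?(negPf h2) ?bt // scaler_nat rpredMn.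
Qed.


(** The last three expressions are the values of [det_at b i2] on sums involving one, two or three
    copies of [t]. Each is affine in [j] with nonzero slope. *)
Lemma stretch_exists b : det_rows b != 0 -> b i2 != 0 ->
  exists j, [/\ (1 < j)%N, j%:R *: b i0 != t, j%:R *: b i1 != t, j%:R *: b i2 != t &
    [/\ j%:R * det_rows b + det_at b i2 t != 0, j%:R * det_rows b + det_at b i2 t *+ 2 != 0 &
        j%:R * (det_rows b *+ 2) + det_at b i2 t *+ 3 != 0]].
Proof.
move=> D0 b20.
have ev i := evt_scale t (det_rows_neq0 i D0).
have D20 : det_rows b *+ 2 != 0 by rewrite mulrn_eq0.
have [N /(_ N (leqnn N))] := evt_and (evt_gt 1) (evt_and (ev i0) (evt_and (ev i1)
  (evt_and (ev i2) (evt_and (evt_affine (det_at b i2 t) D0)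
  (evt_and (evt_affine (det_at b i2 t *+ 2) D0) (evt_affine (det_at b i2 t *+ 3) D20)))))).
by move=> /= /and5P[? ? ? ? /and3P[? ? ?]]; exists N.
Qed.

Lemma shift_coef_off_line a : d != 0 -> inL a -> free [:: d; a] -> f a = 0.
Proof.
move=> d0 aL fda; have /and3P[aH a0 at_neq] := aL.
have [b [b0 b1 D0 bH bt]] := lattice_basis fda dH aH.
have b1t : b i1 != t by rewrite b1.
have [j [j1 jdt jat jbt [c1 _ c3]]] := stretch_exists D0 (det_rows_neq0 _ D0).
have j0 : j%:R != 0 :> K by rewrite pnatr_eq0 -lt0n ltnW.
set D := det_rows b in D0 c1 c3; set T := det_at b i2 t in c1 c3.
(* The first entry is [j d] because [d] itself may equal [t] and so lie outside [Lambda]. *)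
pose x := stretch b (j%:R *: b i0) j.
have jH i : j%:R *: b i \in H by rewrite scaler_nat rpredMn.
have x0 : det_rows x != 0 by rewrite stretch_det !mulf_neq0.
have xL : forall i, inL (x i) by apply: stretch_in_Lambda; rewrite ?bH.
have sumH (y : {ffun 'I_n -> V}) : (forall i, y i \in H) -> \sum_i y i \in H.
  by move=> yH; apply: rpred_sum.
have xH i : x i \in H by case/and3P: (xL i).
have [u uE] : exists u, u = \sum_i x i + t by eexists.
have uH : u \in H by rewrite uE rpredD ?sumH.
(* Up to the factor [D], [det_at b i2] and [det_at b i1] are coordinates in the basis [b]. Usually
   the first shows that a sum is not [0] and the second that it is not [t]. *)
have phi_b k : det_at b i2 (b k) = D *+ (k == i2).
  by case: eqP => [->|/eqP ki]; rewrite ?det_at_id // det_at_row // eq_sym.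
have psi_b k : det_at b i1 (b k) = D *+ (k == i1).
  by case: eqP => [->|/eqP ki]; rewrite ?det_at_id // det_at_row // eq_sym.
have sumx : \sum_i x i = \sum_i b i + (j%:R *: b i0 - b i0) + (j%:R *: b i2 - b i2).
  exact: stretch_sum.
have phi_u : det_at b i2 u = j%:R * D + T.
  rewrite uE sumx !(raddfD, raddfN) /= !linearZ /= det_at_sum !phi_b /= -/D -/T.
  by ring.
have psi_x : det_at b i1 (\sum_i x i) = D.
  rewrite sumx !(raddfD, raddfN) /= !linearZ /= det_at_sum !psi_b /= -/D.
  by ring.
have phi_d : det_at b i2 d = 0 by rewrite -b0 phi_b.
have psi_d : det_at b i1 d = 0 by rewrite -b0 psi_b.
have phi_a : det_at b i2 a = 0 by rewrite -b1 phi_b.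
have psi_a : det_at b i1 a = D by rewrite -b1 psi_b.
have uL : inL u.
  by apply: (in_Lambda_det (b := b) (i := i2) (k := i1) uH); rewrite ?phi_u // uE addrK psi_x.
have udL : inL (u + d).
  apply: (in_Lambda_det (b := b) (i := i2) (k := i1)); first by rewrite rpredD.
    by rewrite raddfD /= phi_u phi_d addr0.
  by rewrite uE addrAC addrK raddfD /= psi_x psi_d addr0.
have dE : d = j%:R^-1 *: x i0 by rewrite !subst_atE /= b0 scalerA mulVf // scale1r.
have := average_of_basis xL x0 dE; rewrite -uE => /(_ udL) avg.
pose x' := subst_at x i1 (j%:R *: a).
have [u' u'D] : exists u', u' = u + (j%:R *: a - a) by eexists.
have x1 : x i1 = a by rewrite !subst_atE /= b1.
have x'0 : det_rows x' != 0.
  by rewrite -/(det_at _ _ _) -x1 linearZ /= det_at_id mulf_neq0.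
have x'L i : inL (x' i).
  apply/and3P; split; last 2 first.
  - exact: det_rows_neq0.
  - by rewrite subst_atE; case: ifP => _; [rewrite -b1 | case/and3P: (xL i)].
  - by rewrite subst_atE; case: ifP => _; [rewrite -b1 | ].
have sumx' : \sum_i x' i = \sum_i x i + (j%:R *: a - a).
  by rewrite (@sum_subst_at _ _ _ id) x1.
have u'E : \sum_i x' i + t = u' by rewrite sumx' u'D uE addrAC.
have u'H : u' \in H.
  by rewrite u'D rpredD // rpredB // -b1.
have phi_u' : det_at b i2 u' = j%:R * D + T.
  by rewrite u'D !(raddfD, raddfN) /= linearZ /= phi_a phi_u; ring.
have psi_x' : det_at b i1 (\sum_i x' i) = j%:R * D.
  by rewrite sumx' !(raddfD, raddfN) /= linearZ /= psi_a psi_x; ring.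
have u'L : inL u'.
  apply: (in_Lambda_det (b := b) (i := i2) (k := i1) u'H); rewrite ?phi_u' //.
  by rewrite -u'E addrK psi_x' mulf_neq0.
have u'dL : inL (u' + d).
  apply: (in_Lambda_det (b := b) (i := i2) (k := i1)); first by rewrite rpredD.
    by rewrite raddfD /= phi_u' phi_d addr0.
  by rewrite -u'E addrAC addrK raddfD /= psi_x' psi_d addr0 mulf_neq0.
have dE' : d = j%:R^-1 *: x' i0 by rewrite subst_atE /= dE.
have := average_of_basis x'L x'0 dE'; rewrite u'E => /(_ u'dL).
rewrite (sum_subst_at f) x1 subst_atE /= => avg'.
have f_ja : f (j%:R *: a) = j%:R * f a.
  pose y := subst_at b i2 (j%:R *: b i2).
  have yD : det_rows y = j%:R * D by rewrite -/(det_at _ _ _) linearZ /= det_at_id.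
  have y0 : y i0 = d by rewrite subst_atE.
  have y1 : y i1 = a by rewrite subst_atE.
  (* The row [d] of [y] gets replaced by [j a], so it may lie outside [Lambda]. *)
  have yH i : y i \in H by rewrite subst_atE; case: ifP.
  have D'0 : det_rows y != 0 by rewrite yD mulf_neq0.
  have yL i : i != i0 -> inL (y i).
    move=> ii0; apply/and3P; split=> //; first exact: det_rows_neq0.
    rewrite subst_atE; case: ifP => // _.
    by have [->//|ii1] := eqVneq i i1; apply: bt.
  have sumy : \sum_(i | i != i0) y i = \sum_i b i - d + (j%:R *: b i2 - b i2).
    by rewrite sum_subst_other // b0.
  have w1 : j%:R *: y i1 + 0 *: y i2 = j%:R *: a by rewrite scale0r addr0 y1.
  have := @additive_modulo_shift y i0 i1 i2 j%:R 0 isT isT isT y0 D'0 yL.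
  rewrite w1 y1 mul0r addr0; apply.
    by rewrite -b1; apply/and3P; rewrite jH jat scaler_eq0 negb_or j0 det_rows_neq0.
  rewrite sumy; apply: (in_Lambda_det (b := b) (i := i2) (k := i1)).
  - by rewrite !(rpredD, rpredN, sumH) //; rewrite -b1.
  - rewrite !(raddfD, raddfN) /= !linearZ /= det_at_sum phi_a phi_d phi_b -/T -/D /=.
    by apply: contra_neq c1 => <-; ring.
  - rewrite !(raddfD, raddfN) /= !linearZ /= det_at_sum psi_a psi_d psi_b -/D /=.
    have : j.+1%:R * D != 0 by rewrite mulf_neq0 ?pnatr_eq0.
    by apply: contra_neq => <-; rewrite -natr1; ring.
have f_u' : f u' = f u + (j%:R - 1) * f a.
  (* The basis [(d, a, u, b_3, ...)] expresses [u'] as [(j - 1) a + u]. *)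
  pose y := subst_at b i2 u.
  have D'0 : det_rows y != 0 by rewrite -/(det_at _ _ _) phi_u.
  have y0 : y i0 = d by rewrite subst_atE.
  have y1 : y i1 = a by rewrite subst_atE.
  have y2 : y i2 = u by rewrite subst_atE.
  have yL i : i != i0 -> inL (y i).
    move=> ii0; rewrite subst_atE; case: ifP => // _.
    have [->//|ii1] := eqVneq i i1; first by rewrite b1.
    by apply/and3P; rewrite bH det_rows_neq0 ?bt.
  have sumy : \sum_(i | i != i0) y i = \sum_i b i - d + (u - b i2).
    by rewrite sum_subst_other // b0.
  have w1 : (j%:R - 1) *: y i1 + 1 *: y i2 = u'.
    by rewrite u'D y1 y2 scale1r scalerBl scale1r addrC.
  have := @additive_modulo_shift y i0 i1 i2 (j%:R - 1) 1 isT isT isT y0 D'0 yL.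
  rewrite w1 y1 y2 mul1r addrC [RHS]addrC; apply=> //.
  (* Both [u] and [u'] contain [t], whose coordinate along [b i1] is unknown. Hence [b i2] serves
     for both tests, with values [2 j D + 3 T] and [2 (j D + T)]. *)
  rewrite sumy; apply: (in_Lambda_det (b := b) (i := i2) (k := i2)).
  - by rewrite !(rpredD, rpredN, sumH).
  - rewrite !(raddfD, raddfN) /= det_at_sum phi_u' phi_u phi_d phi_b -/T -/D /=.
    by apply: contra_neq c3 => <-; ring.
  - rewrite !(raddfD, raddfN) /= det_at_sum phi_u' phi_u phi_d phi_b -/T -/D /=.
    have : 2%:R * (j%:R * D + T) != 0 by rewrite mulf_neq0 ?pnatr_eq0.
    by apply: contra_neq => <-; ring.
have e : n%:R * f u' - n%:R * f u = f (j%:R *: a) - f a.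
  by rewrite !(mulr_natl _ n) avg avg'; ring.
(* Both scalar factors are nonzero, since [1 < j] and [n] is at least 3. *)
have : (j%:R - 1) * (n%:R - 1) * f a = 0.
  move: e; rewrite f_u' f_ja; move: (n%:R : K) => N e.
  have -> : (j%:R - 1) * (N - 1) * f a =
    N * (f u + (j%:R - 1) * f a) - N * f u - (j%:R * f a - f a) by ring.
  by rewrite e subrr.
move/eqP; rewrite -mulrA mulf_eq0 => /orP[|/eqP].
  by rewrite subr_eq0 -[1]/(1%:R) eqr_nat gtn_eqF.
move/eqP; rewrite mulf_eq0 => /orP[|/eqP//].
by rewrite subr_eq0 -[1]/(1%:R) eqr_nat.
Qed.

(* For [c = -1] the target index [c *: d + d] is [0], and [f_id] carries no
   information. *)
Lemma shift_coef_on_line c : d != 0 -> c != -1 -> inL (c *: d) -> f (c *: d) = 0.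
Proof.
move=> d0 c1 cL; have /and3P[cH cd0 cdt] := cL.
have [h [hH ht fhd]] : exists h, [/\ h \in H, h != t & free [:: h; d]].
  by apply: free_extend; rewrite ?free_cons ?span_nil ?memv0 ?d0 ?nil_free.
have fdh : free [:: d; h] by rewrite (perm_free (permEl (perm_catC [:: d] [:: h]))).
have [b [b0 b1 D0 bH bt]] := lattice_basis fdh dH hH.
have b1t : b i1 != t by rewrite b1.
have [j [j1 _ _ jbt [c2 _ _]]] := stretch_exists D0 (det_rows_neq0 _ D0).
have j0 : j%:R != 0 :> K by rewrite pnatr_eq0 -lt0n ltnW.
have c0 : c != 0 by apply: contra_neq cd0 => ->; rewrite scale0r.
pose x := stretch b (c *: b i0) j.
have x0 : det_rows x != 0 by rewrite stretch_det !mulf_neq0.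
have xL : forall i, inL (x i) by apply: stretch_in_Lambda => //; rewrite b0.
have xi0 : x i0 = c *: d by rewrite !subst_atE /= b0.
have det_d k : k != i0 -> det_at b k d = 0 by move=> ki0; rewrite -b0 det_at_row.
have sumx : \sum_i x i = \sum_i b i + (c *: b i0 - b i0) + (j%:R *: b i2 - b i2).
  exact: stretch_sum.
have fx i : i != i0 -> f (x i) = 0.
  move=> ii0; apply: shift_coef_off_line => //.
  have xd : det_at x i d = 0.
    have -> : d = c^-1 *: x i0 by rewrite xi0 scalerA mulVf // scale1r.
    by rewrite linearZ /= det_at_row // mulr0.
  by apply: (free2_det d0 xd); rewrite det_at_id.
have [u uE] : exists u, u = \sum_i x i + t by eexists.
have phi_u : det_at b i2 u = j%:R * det_rows b + det_at b i2 t.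
  rewrite uE sumx !(raddfD, raddfN) /= !linearZ /= det_at_sum b0 det_d // det_at_id.
  by ring.
have psi_x : det_at b i1 (\sum_i x i) = det_rows b.
  rewrite sumx !(raddfD, raddfN) /= !linearZ /= det_at_sum b0 det_d // det_at_row //.
  by ring.
have uH : u \in H by rewrite uE rpredD // rpred_sum // => i _; case/and3P: (xL i).
have uL : inL u.
  by apply: (in_Lambda_det (b := b) (i := i2) (k := i1) uH); rewrite ?phi_u // uE addrK psi_x.
have udL : inL (u + d).
  apply: (in_Lambda_det (b := b) (i := i2) (k := i1)); first by rewrite rpredD.
    by rewrite raddfD /= phi_u det_d // addr0.
  by rewrite uE addrAC addrK raddfD /= psi_x det_d // addr0.
have fu : f u = 0.
  by apply: shift_coef_off_line => //; apply: (free2_det d0 (det_d i2 isT)); rewrite phi_u.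
have dE : d = c^-1 *: x i0 by rewrite xi0 scalerA mulVf // scale1r.
have := average_of_basis xL x0 dE; rewrite -uE => /(_ udL).
(* Everything off the line of [d] vanishes, leaving [0 = f (c d) + c^-1 f (c d)]. *)
rewrite fu mul0rn (bigD1 i0) //= big1 ?addr0 // xi0 => e.
have : (c + 1) * f (c *: d) = 0.
  by rewrite -[RHS](mulr0 c) e; field.
by move/eqP; rewrite mulf_eq0 addr_eq0 (negPf c1) => /eqP.
Qed.

(** On the line of [d], the exceptional case [a = - d] is excluded by [a + d != 0]. *)
Lemma shift_coef_eq0 a : d != 0 -> inL a -> inL (a + d) -> f a = 0.
Proof.
move=> d0 aL /and3P[_ ad0 _].
have [/vlineP[c ac]|ad] := boolP (a \in <[d]>%VS).
  rewrite ac; apply: shift_coef_on_line; rewrite -?ac //.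
  by apply: contra_neq ad0 => c1; rewrite ac c1 scaleN1r addNr.
apply: shift_coef_off_line => //.
by rewrite (perm_free (permEl (perm_catC [:: d] [:: a]))); apply/free2P.
Qed.

(* The family [y] replaces [stretch b _ j i2] by the sum [w]: adding [a] to [v] or
   to [w] in [y] gives equal sums. *)
Lemma shift_coef_translate a v : d = 0 -> free [:: a; v] -> a \in H ->
  inL v -> inL (v + a) -> f (v + a) = f v.
Proof.
move=> d0 fav aH vL vaL; have /and3P[vH v0 vt] := vL.
have [b [b0 b1 D0 bH bt]] := lattice_basis fav aH vH.
have b1t : b i1 != t by rewrite b1.
have [j [j1 jat _ jbt [c1 c2 _]]] := stretch_exists D0 (det_rows_neq0 _ D0).
have j0 : j%:R != 0 :> K by rewrite pnatr_eq0 -lt0n ltnW.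
set D := det_rows b in D0 c1 c2; set T := det_at b i2 t in c1 c2.
have avg x : (forall i, inL (x i)) -> det_rows x != 0 -> inL (\sum_i x i + t) ->
    f (\sum_i x i + t) *+ n = \sum_i f (x i).
  move=> xL x0 eL.
  by rewrite (@average_of_basis x i0 0) ?mul0r ?addr0 ?scale0r ?d0 // addr0.
have jH i : j%:R *: b i \in H by rewrite scaler_nat rpredMn.
have phi_b k : det_at b i2 (b k) = D *+ (k == i2).
  by case: eqP => [->|/eqP ki]; rewrite ?det_at_id // det_at_row // eq_sym.
have psi_b k : det_at b i1 (b k) = D *+ (k == i1).
  by case: eqP => [->|/eqP ki]; rewrite ?det_at_id // det_at_row // eq_sym.
have phi_a : det_at b i2 a = 0 by rewrite -b0 phi_b.
have psi_a : det_at b i1 a = 0 by rewrite -b0 psi_b.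
pose x := stretch b (j%:R *: b i0) j.
have x0 : det_rows x != 0 by rewrite stretch_det !mulf_neq0.
have xL : forall i, inL (x i) by apply: stretch_in_Lambda; rewrite ?jH.
have sumx : \sum_i x i = \sum_i b i + (j%:R *: b i0 - b i0) + (j%:R *: b i2 - b i2).
  exact: stretch_sum.
have xi0 : x i0 = j%:R *: a by rewrite !subst_atE /= b0.
have xi1 : x i1 = v by rewrite !subst_atE /= b1.
have [w wE] : exists w, w = \sum_i x i + t by eexists.
have phi_w : det_at b i2 w = j%:R * D + T.
  rewrite wE sumx !(raddfD, raddfN) /= !linearZ /= det_at_sum !phi_b /= -/D -/T.
  by ring.
have psi_x : det_at b i1 (\sum_i x i) = D.
  rewrite sumx !(raddfD, raddfN) /= !linearZ /= det_at_sum !psi_b /= -/D.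
  by ring.
have wH : w \in H by rewrite wE rpredD // rpred_sum // => i _; case/and3P: (xL i).
have wL : inL w.
  by apply: (in_Lambda_det (b := b) (i := i2) (k := i1) wH); rewrite ?phi_w // wE addrK psi_x.
have waL : inL (w + a).
  apply: (in_Lambda_det (b := b) (i := i2) (k := i1)); first by rewrite rpredD.
    by rewrite raddfD /= phi_w phi_a addr0.
  by rewrite wE addrAC addrK raddfD /= psi_x psi_a addr0.
(* Since row [i0] is [j a], adding [a] to another row is a shear with factor [j^-1]. *)
have shear (y : {ffun 'I_n -> V}) k : y i0 = j%:R *: a -> k != i0 ->
    det_rows (subst_at y k (y k + a)) = det_rows y.
  move=> y0 ki0; rewrite -(det_rows_shear y j%:R^-1 ki0) y0.
  by rewrite scalerA mulVf // scale1r.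
have substL (y : {ffun 'I_n -> V}) k z : (forall i, inL (y i)) -> inL z -> forall i, inL (subst_at y k z i).
  by move=> yL zL i; rewrite subst_atE; case: ifP.
pose x1 := subst_at x i1 (x i1 + a).
have sumx1 : \sum_i x1 i + t = w + a.
  by rewrite (@sum_subst_at _ _ _ id) [_ + a]addrC addrK addrAC -wE.
have avg1 : f (w + a) *+ n = \sum_i f (x i) + (f (v + a) - f v).
  rewrite -sumx1 (avg x1) ?sumx1 //; last 2 first.
  - by apply: substL; rewrite // xi1.
  - by rewrite /x1 shear.
  by rewrite (sum_subst_at f) xi1.
have := avg x xL x0; rewrite -wE => /(_ wL) avg0.
pose y := subst_at x i2 w.
have yi0 : y i0 = j%:R *: a by rewrite subst_atE.
have yi1 : y i1 = v by rewrite subst_atE.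
have yi2 : y i2 = w by rewrite subst_atE.
have yL := substL x i2 w xL wL.
have y0 : det_rows y != 0.
  rewrite /y /x /stretch subst_at2 -/(det_at _ _ _) det_at_scale //.
  by rewrite phi_w mulf_neq0.
have sumy : \sum_i y i = \sum_i x i + (w - j%:R *: b i2).
  by rewrite (@sum_subst_at _ _ _ id) subst_atE.
have yaL : inL (\sum_i y i + a + t).
  have phi_ya : det_at b i2 (\sum_i y i + a) = j%:R * D + T.
    rewrite sumy !(raddfD, raddfN) /= phi_w phi_a sumx !(raddfD, raddfN) /= !linearZ /=.
    by rewrite det_at_sum !phi_b /= -/D; ring.
  (* As [w] contains [t], the coordinate along [b i2] serves for both tests, with values [j D + 2 T]
     and [j D + T]. *)
  apply: (in_Lambda_det (b := b) (i := i2) (k := i2)).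
  - by rewrite !rpredD // rpred_sum // => i _; case/and3P: (yL i).
  - by rewrite raddfD /= phi_ya -addrA -mulr2n.
  - by rewrite addrK phi_ya.
have sum1 : \sum_i subst_at y i1 (y i1 + a) i + t = \sum_i y i + a + t.
  by rewrite (@sum_subst_at _ _ _ id) [_ + a]addrC addrK.
have sum2 : \sum_i subst_at y i2 (y i2 + a) i + t = \sum_i y i + a + t.
  by rewrite (@sum_subst_at _ _ _ id) [_ + a]addrC addrK.
have e1 : f (\sum_i y i + a + t) *+ n = \sum_i f (y i) + (f (v + a) - f v).
  rewrite -sum1 (avg (subst_at y i1 (y i1 + a))) ?sum1 ?shear //; last by apply: substL; rewrite // yi1.
  by rewrite (sum_subst_at f) yi1.
have e2 : f (\sum_i y i + a + t) *+ n = \sum_i f (y i) + (f (w + a) - f w).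
  rewrite -sum2 (avg (subst_at y i2 (y i2 + a))) ?sum2 ?shear //; last by apply: substL; rewrite // yi2.
  by rewrite (sum_subst_at f) yi2.
have bw : f (v + a) - f v = f (w + a) - f w.
  by apply: (addrI (\sum_i f (y i))); rewrite -e1 e2.
have e : n%:R * f (w + a) - n%:R * f w = f (v + a) - f v.
  by rewrite !(mulr_natl _ n) avg1 avg0; ring.
have nb : (n%:R - 1) * (f (v + a) - f v) = 0.
  by rewrite mulrBl mul1r {1}bw mulrBr e subrr.
move/eqP: nb; rewrite mulf_eq0 !subr_eq0 => /orP[|/eqP//].
by rewrite -[1]/(1%:R) eqr_nat.
Qed.

(** Independent vectors differ by a translation as above; collinear ones are compared through some
    [h] off their common line. *)
Lemma shift_coef_const a v : d = 0 -> inL a -> inL v -> f a = f v.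
Proof.
move=> d0 aL vL.
have indep (x y : V) : inL x -> inL y -> free [:: x; y] -> f x = f y.
  move=> xL yL fxy; have /and3P[xH _ _] := xL; have /and3P[yH y0 _] := yL.
  have xyx : y + (x - y) = x by rewrite addrC subrK.
  rewrite -{1}xyx; apply: shift_coef_translate; rewrite ?xyx ?rpredB //.
  apply/free2P; split=> //; have /free2P[_] := fxy; apply: contra => xyy.
  by rewrite -xyx memvD ?memv_line.
have [h [hH ht fha]] : exists h, [/\ h \in H, h != t & free [:: h; a]].
  have /and3P[_ a0 _] := aL.
  by apply: free_extend; rewrite ?free_cons ?span_nil ?memv0 ?a0 ?nil_free.
have [va|va] := boolP (v \in <[a]>%VS); last first.
  by apply/esym/indep => //; apply/free2P; split=> //; case/and3P: aL.
have /free2P[a0 hNa] := fha.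
have h0 : h != 0 by apply: contraNneq hNa => ->; rewrite mem0v.
have hL : inL h by apply/and3P.
have v0 : v != 0 by case/and3P: vL.
rewrite -(indep h a) //; apply: indep => //; apply/free2P; split=> //.
apply: contra hNa => /vlineP[c ->]; exact: memvZ.
Qed.

End ShiftCoefficients.

(** * From the coefficients back to the derivation *)

Section InverseDerivations.
Variables (K : numFieldType) (m : nat).
Local Notation n := m.+3.
Variables (H : zmodClosed 'rV[K]_n) (t : 'rV[K]_n).
Hypotheses (H_spans : forall v, in_span H v) (tH : t \in H) (t0 : t != 0).
Local Notation Pspace := {malg K[Lambda H t]}.

Local Opaque Pbracket Pu fgzero fgadd fgopp fgscale mkmalgU.

Lemma inv_n_derivation_scalar (T : Pspace -> Pspace) : linear T ->
  (forall x : {ffun 'I_n -> Pspace},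
    \sum_(i < n) Pbracket (subst_at x i (T (x i))) = T (Pbracket x) *+ n) ->
  exists c, forall z, T z = c *: z.
Proof.
move=> T_linear T_der.
have f_id d := shift_coef_identity T_linear T_der (d := d).
have kL (k : Lambda H t) : in_Lambda H t (val k) := valP k.
have [c cE] : exists c, forall k : Lambda H t, shift_coef T 0 (val k) = c.
  have [[k0]|no] := pselect (inhabited (Lambda H t)); last by exists 0 => k; case: no.
  exists (shift_coef T 0 (val k0)) => k.
  by apply: (shift_coef_const H_spans tH t0 (f_id 0)).
have T_basis (k : Lambda H t) : T << k >> = c *: << k >>.
  apply/malgP => l; rewrite [RHS]mcoeffZ mcoeffU coefuE -Pu_val.
  (* The coefficient of [T << k >>] at [l] belongs to the shift [val l - val k], which is zero
     exactly on the diagonal. *)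
  have -> : val l = val k + (val l - val k) by rewrite addrC subrK.
  rewrite -/(shift_coef T (val l - val k) (val k)).
  have [<-|kl] := eqVneq k l; first by rewrite subrr cE mulr1.
  have /and3P[kH _ _] := kL k; have /and3P[lH _ _] := kL l.
  rewrite mulr0; apply: (shift_coef_eq0 H_spans tH t0 _ (f_id _)) => //.
  - exact: rpredB.
  - by rewrite subr_eq0 eq_sym val_eqE.
  - by rewrite addrC subrK.
exists c; elim/malg_ind => [|a k z hk hz|k]; last exact: T_basis.
- by have := T_linear (-1) 0 0; rewrite !scaler0 addr0 scaleN1r addNr.
- by rewrite T_linear hk hz scalerDr !scalerA mulrC.
Qed.

Lemma scalar_inv_n_derivation c (x : {ffun 'I_n -> Pspace}) :
  \sum_(i < n) Pbracket (subst_at x i (c *: x i)) = (c *: Pbracket x) *+ n.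
Proof.
rewrite (eq_bigr (fun=> c *: Pbracket x)) => [|i _].
  by rewrite sumr_const card_ord.
by rewrite PbracketZ subst_at_id.
Qed.

End InverseDerivations.

Local Open Scope classical_set_scope.

Theorem theorem5p3 (R : realType) (n : nat) (n_ge3 : (3 <= n)%N)
    (H : zmodClosed 'rV[R[i]]_n) (H_spans : forall v, in_span H v)
    (t : 'rV[R[i]]_n) (tH : t \in H) (t_neq0 : t != 0) :
  inv_n_derivations (P H t tH) = [set (fun x => c *: x) | c in [set: R[i]]].
Proof.
case: n n_ge3 H H_spans t tH t_neq0 => [|[|[|m]]] // _ H H_spans t tH t_neq0.
apply/seteqP; split=> [T [T_linear T_der]|_ [c _ <-]].
  have [c cE] := inv_n_derivation_scalar H_spans tH t_neq0 T_linear T_der.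
  by exists c => //; apply/funext => z; rewrite cE.
split=> [a x y|x]; last exact: scalar_inv_n_derivation.
by rewrite scalerDr !scalerA mulrC.
Qed.
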